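(* Let $n\geq 1$, let $x_1,\ldots,x_n$ be elements of a commutative Banach algebra, and let $K$ be a compact subset of $$\{s\in\mathbb{C}^n:|s_1^{i_1}\cdots s_n^{i_n}|\leq\lVert x_1^{i_1}\cdots x_n^{i_n}\rVert\text{ for all integers }i_1,\ldots,i_n\geq 0\}.$$ Then there exist a commutative Banach algebra $B$ and elements $y_1,\ldots,y_n\in B$ such that $\lVert y_1^{i_1}\cdots y_n^{i_n}\rVert=\lVert x_1^{i_1}\cdots x_n^{i_n}\rVert$ for all integers $i_1,\ldots,i_n\geq 0$ and $\sigma(y_1,\ldots,y_n)=\sigma(x_1,\ldots,x_n)\cup K$.
   Context: Banach algebras are complex and unital, with submultiplicative norm and $\lVert 1\rVert=1$. For elements $x_1,\ldots,x_n$ of a commutative Banach algebra $A$, the joint spectrum is $\sigma(x_1,\ldots,x_n)=\{(\phi(x_1),\ldots,\phi(x_n)):\phi\in\mathcal{M}_A\}\subset\mathbb{C}^n$, where $\mathcal{M}_A$ is the set of nonzero multiplicative linear functionals $A\to\mathbb{C}$. Convention: $0^0=1$. *)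

(* Defs.v *)
From HB Require Import structures.
From mathcomp Require Import all_boot all_order all_algebra complex.
From mathcomp Require Import boolp classical_sets reals topology normedtype.

Set Implicit Arguments.
Unset Strict Implicit.
Unset Printing Implicit Defensive.

Import Order.TTheory GRing.Theory Num.Theory.
Import numFieldNormedType.Exports.

Local Open Scope classical_set_scope.
Local Open Scope ring_scope.
Local Open Scope complex_scope.

(* The instances exported by [numFieldNormedType] are keyed on abstract fields,
   so they are not found for the concrete type [R[i]].  This gives [R[i]] (and
   hence ['rV[R[i]]_n]) the topology defined by its modulus. *)
HB.instance Definition _ (R : realType) := NormedModule.copy R[i] R[i]^o.

(* Hierarchy-Builder rejects a common extension of the library's rings and
   normed modules, because [numDomainType] already is one and no structure sits
   in between.  So the norm of an algebra is an operation [anorm] of its own,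
   with values in [K] as for [normedModType K], and [normed_space A] below is
   the normed module that it defines on the vector space [A].  Nonnegativity of
   [anorm] follows from the axioms. *)
HB.mixin Record isNormedAlgebra (K : numFieldType) A & GRing.Algebra K A := {
  anorm : A -> K ;
  anormD : forall x y : A, anorm (x + y) <= anorm x + anorm y ;
  anormZ : forall (a : K) (x : A), anorm (a *: x) = `|a| * anorm x ;
  anorm0_eq0 : forall x : A, anorm x = 0 -> x = 0 ;
  anormM : forall x y : A, anorm (x * y) <= anorm x * anorm y ;
  anorm1 : anorm 1 = 1
}.

#[short(type="normedAlgType")]
HB.structure Definition NormedAlgebra (K : numFieldType) :=
  {A of GRing.Algebra K A & isNormedAlgebra K A}.

Definition normed_space (K : numFieldType) (A : normedAlgType K) : Type := A.

HB.instance Definition _ (K : numFieldType) (A : normedAlgType K) :=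
  GRing.Lmodule.on (normed_space A).

HB.instance Definition _ (K : numFieldType) (A : normedAlgType K) :=
  Lmodule_isNormed.Build K (normed_space A)
    (@anormD K A) (@anormZ K A) (@anorm0_eq0 K A).

HB.mixin Record NormedAlgebra_isComplete (K : numFieldType) A
    & NormedAlgebra K A := {
  anorm_complete : forall F : set_system (normed_space A),
    ProperFilter F -> cauchy F -> cvg F
}.

#[short(type="comBanachAlgType")]
HB.structure Definition ComBanachAlgebra (K : numFieldType) :=
  {A of GRing.ComAlgebra K A & NormedAlgebra K A
   & NormedAlgebra_isComplete K A}.

Definition characters (K : numFieldType) (A : comBanachAlgType K) :
    set {scalar A} :=
  [set phi : {scalar A} | {morph phi : a b / a * b} /\ exists a, phi a != 0].

Definition joint_spectrum (K : numFieldType) (A : comBanachAlgType K)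
    (n : nat) (x : 'I_n -> A) : set 'rV[K]_n :=
  [set \row_(j < n) phi (x j) | phi in @characters K A].

(* Main.v *)
Require Import Defs.
From HB Require Import structures.
From mathcomp Require Import all_boot all_order all_algebra complex.
From mathcomp Require Import boolp classical_sets reals topology normedtype.
From mathcomp Require Import functions prodnormedzmodule.

(** When [K] is empty, take [B = A] and [y = x].  Otherwise enlarge the spectrum
    by adding a second factor: let [B] be the product of [A] with an algebra of
    functions whose coordinate functions have joint spectrum [K], under the
    maximum of the two norms, and let [y j] be the pair of [x j] and the [j]-th
    coordinate function.  The norm of a monomial in the [y j] is the maximum of
    the norm of the same monomial in the [x j] and of its supremum on [K], and
    the assumption on [K] says exactly that the second does not exceed the
    first.

    A character of a product of two algebras sees exactly one of the idempotents
    [(1, 0)] and [(0, 1)], hence factors through one of the projections; so the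
    joint spectrum of a family of pairs is the union of the two joint spectra
    ([joint_spectrum_prod]).

    It is enough to take for the second factor all bounded functions, instead
    of the continuous functions on [K]: only the values of its characters at the
    coordinate functions matter.  If such a tuple of values [l] were outside the
    closed set [K], the differences of the coordinate functions and the
    constants [l j] would be jointly bounded away from 0, hence would generate
    the unit ideal ([linf_unimodular]); but a character taking the values [l j]
    kills all of them ([joint_spectrum_linf]). *)

Set Implicit Arguments.
Unset Strict Implicit.
Unset Printing Implicit Defensive.

Import Order.TTheory GRing.Theory Num.Theory.
Import numFieldNormedType.Exports.

Local Open Scope classical_set_scope.
Local Open Scope ring_scope.
Local Open Scope complex_scope.

(** * Banach algebras *)

Section NormedAlgebraTheory.
Variables (K : numFieldType) (A : normedAlgType K).

Lemma normed_spaceE (a : normed_space A) : `|a| = anorm a.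
Proof. by []. Qed.

Lemma anorm_ge0 (a : A) : 0 <= anorm a.
Proof. exact: (normr_ge0 (a : normed_space A)). Qed.

End NormedAlgebraTheory.

(** * Products *)

Section ProductAlgebra.
Variables (K : numFieldType).

Section NormedProduct.
Variables (A B : normedAlgType K).

(** The norm is that of the product of the underlying normed spaces, from which
    the axioms that do not involve multiplication are inherited. *)
Definition prod_anorm (p : A * B) : K :=
  `|(p : normed_space A * normed_space B)|.

Lemma prod_anormE (p : A * B) : prod_anorm p = Num.max (anorm p.1) (anorm p.2).
Proof. by []. Qed.

Lemma prod_anormP (p : A * B) (M : K) :
  (prod_anorm p <= M) = (anorm p.1 <= M) && (anorm p.2 <= M).
Proof.
rewrite prod_anormE comparable_ge_max //.
by apply: real_comparable; exact/ger0_real/anorm_ge0.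
Qed.

Fact prod_anormM (p q : A * B) :
  prod_anorm (p * q) <= prod_anorm p * prod_anorm q.
Proof.
have [p1 p2] : anorm p.1 <= prod_anorm p /\ anorm p.2 <= prod_anorm p.
  by apply/andP; rewrite -prod_anormP.
have [q1 q2] : anorm q.1 <= prod_anorm q /\ anorm q.2 <= prod_anorm q.
  by apply/andP; rewrite -prod_anormP.
rewrite prod_anormP; apply/andP; split.
  by apply: (le_trans (anormM _ _)); apply: ler_pM => //; exact: anorm_ge0.
by apply: (le_trans (anormM _ _)); apply: ler_pM => //; exact: anorm_ge0.
Qed.

Fact prod_anorm1 : prod_anorm 1 = 1.
Proof. by rewrite prod_anormE /= !anorm1 maxxx. Qed.

HB.instance Definition _ := isNormedAlgebra.Build K (A * B)%type
  (fun p q => ler_normD (p : normed_space A * normed_space B) q)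
  (fun a p => normrZ a (p : normed_space A * normed_space B))
  (fun p => @normr0_eq0 _ (normed_space A * normed_space B)%type p)
  prod_anormM prod_anorm1.

Lemma anorm_pairE (p : A * B) : anorm p = Num.max (anorm p.1) (anorm p.2).
Proof. by []. Qed.

End NormedProduct.

Section BanachProduct.
Variables (A B : comBanachAlgType K).

Fact prod_anorm_complete (F : set_system (normed_space (A * B)%type)) :
  ProperFilter F -> cauchy F -> cvg F.
Proof.
move=> FF /cauchyP F_cauchy.
pose F1 : set_system (normed_space A) := (@fst A B) @ F.
pose F2 : set_system (normed_space B) := (@snd A B) @ F.
have ballP (p q : normed_space (A * B)%type) (e : K) :
    ball p e q <-> ball (p.1 : normed_space A) e q.1 /\
                   ball (p.2 : normed_space B) e q.2.
  rewrite -!ball_normE /= normed_spaceE anorm_pairE comparable_gt_max.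
    by split=> [/andP|[? ?]] //; apply/andP.
  by apply: real_comparable; exact/ger0_real/anorm_ge0.
have /cvg_ex[a Fa] : cvg F1.
  apply: anorm_complete; apply/cauchyP => e /F_cauchy[p Fp]; exists p.1.
  by apply: (@filterS _ F _ _ _ _ Fp) => q /ballP[].
have /cvg_ex[b Fb] : cvg F2.
  apply: anorm_complete; apply/cauchyP => e /F_cauchy[p Fp]; exists p.2.
  by apply: (@filterS _ F _ _ _ _ Fp) => q /ballP[].
apply/cvg_ex; exists (a, b); apply/cvg_ballP => e e0; near=> p.
by apply/ballP; split; near: p; [move/cvg_ballP: Fa|move/cvg_ballP: Fb]; exact.
Unshelve. all: by end_near. Qed.

HB.instance Definition _ :=
  NormedAlgebra_isComplete.Build K (A * B)%type prod_anorm_complete.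

End BanachProduct.

End ProductAlgebra.

(** * Characters *)

Section Characters.
Variables (K : numFieldType).

(** Characters are bundled linear forms, which hides how they are built: this
    lets a character be given by a plain function, such as a composition with a
    projection or an evaluation. *)
Lemma character_of (A : comBanachAlgType K) (f : A -> K) :
    scalar f -> {morph f : a b / a * b} -> f 1 != 0 ->
  exists2 phi : {scalar A}, characters phi & phi =1 f.
Proof.
move=> f_lin fM f1.
pose phi : {scalar A} := HB.pack f (GRing.isLinear.Build K A K *%R f f_lin).
by exists phi => //; split; [exact: fM|exists 1].
Qed.

Lemma character1 (A : comBanachAlgType K) (phi : {scalar A}) :
  characters phi -> phi 1 = 1.
Proof.
move=> [phiM [a phia]]; apply: (mulfI phia).
by rewrite -phiM !mulr1.
Qed.

Lemma joint_spectrum_mem (A : comBanachAlgType K) n (x : 'I_n -> A)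
    (f : A -> K) :
    scalar f -> {morph f : a b / a * b} -> f 1 != 0 ->
  joint_spectrum x (\row_j f (x j)).
Proof.
move=> f_lin fM f1; have [phi phiP phiE] := character_of f_lin fM f1.
by exists phi => //; apply/rowP => j; rewrite !mxE phiE.
Qed.

(** Since [phi e1 * phi e2 = 0] and [phi e1 + phi e2 = 1] for the idempotents
    [e1 = (1, 0)] and [e2 = (0, 1)], one of the two values is 0 and the other is
    1.  If [phi e1 = 0], then [phi] only depends on the second component, and if
    [phi e2 = 0], only on the first. *)
Lemma joint_spectrum_prod (A B : comBanachAlgType K) n
    (x : 'I_n -> A) (y : 'I_n -> B) :
  joint_spectrum (fun j => (x j, y j)) = joint_spectrum x `|` joint_spectrum y.
Proof.
apply/seteqP; split=> [_ [phi phiP <-]|_ [[phi phiP <-]|[phi phiP <-]]].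
- have phi1 := character1 phiP; case: phiP => phiM _.
  pose e1 : A * B := (1, 0); pose e2 : A * B := (0, 1).
  have phie : phi e1 + phi e2 = 1.
    by rewrite -raddfD -phi1; congr (phi (_, _)); rewrite ?addr0 ?add0r.
  have phie0 : phi e1 * phi e2 = 0.
    rewrite -phiM -[RHS](raddf0 phi).
    by congr (phi (_, _)); rewrite ?mulr0 ?mul0r.
  have phi_fst a b : phi (a, b) * phi e1 = phi (a, 0).
    by rewrite -phiM; congr (phi (_, _)); rewrite /= ?mulr0 ?mulr1.
  have phi_snd a b : phi (a, b) * phi e2 = phi (0, b).
    by rewrite -phiM; congr (phi (_, _)); rewrite /= ?mulr0 ?mulr1.
  have /orP[/eqP e10|/eqP e20] : (phi e1 == 0) || (phi e2 == 0).
  + by rewrite -mulf_eq0 phie0.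
  + right; rewrite e10 add0r in phie.
    rewrite (_ : \row_j _ = \row_j (phi (0, y j))); last first.
      by apply/rowP => j; rewrite !mxE -(phi_snd (x j)) phie mulr1.
    apply: (@joint_spectrum_mem B n y (fun b => phi (0, b))).
    * move=> k u v; rewrite -linearP; congr (phi (_, _)).
      by rewrite /= scaler0 addr0.
    * by move=> u v; rewrite -phiM; congr (phi (_, _)); rewrite /= mul0r.
    * by rewrite phie oner_neq0.
  + left; rewrite e20 addr0 in phie.
    rewrite (_ : \row_j _ = \row_j (phi (x j, 0))); last first.
      by apply/rowP => j; rewrite !mxE -(phi_fst _ (y j)) phie mulr1.
    apply: (@joint_spectrum_mem A n x (fun a => phi (a, 0))).
    * move=> k u v; rewrite -linearP; congr (phi (_, _)).
      by rewrite /= scaler0 addr0.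
    * by move=> u v; rewrite -phiM; congr (phi (_, _)); rewrite /= mul0r.
    * by rewrite phie oner_neq0.
- apply: (@joint_spectrum_mem (A * B)%type n (fun j => (x j, y j))
            (fun p => phi p.1)).
  + by move=> k u v; rewrite /= linearP.
  + by move=> u v; rewrite /= phiP.1.
  + by rewrite (character1 phiP) oner_neq0.
- apply: (@joint_spectrum_mem (A * B)%type n (fun j => (x j, y j))
            (fun p => phi p.2)).
  + by move=> k u v; rewrite /= linearP.
  + by move=> u v; rewrite /= phiP.1.
  + by rewrite (character1 phiP) oner_neq0.
Qed.

End Characters.

(** * Completeness of the complex numbers *)

Lemma normci (R : rcfType) : `|'i| = 1 :> R[i].
Proof. by rewrite normc_def /= expr0n add0r expr1n sqrtr1. Qed.

Lemma normc_real (R : rcfType) (r : R) : `|r%:C| = `|r|%:C.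
Proof. by rewrite normc_def /= expr0n addr0 sqrtr_sqr. Qed.

(** Real and imaginary parts do not increase distances, so they send a Cauchy
    filter to Cauchy filters on the complete field of real numbers. *)
Lemma complex_complete (R : realType) (F : set_system R[i]) :
  ProperFilter F -> cauchy F -> cvg F.
Proof.
move=> FF /cauchyP F_cauchy.
have cvg_part (h : R[i] -> R) :
    (forall z w, `|h z - h w|%:C <= `|z - w|) ->
    exists r : R, forall e, 0 < e -> \forall z \near F, `|r - h z| < e.
  move=> h_lip; have /cvg_ex[r Fr] : cvg (h z @[z --> F]).
    apply: cauchy_cvg; apply/cauchyP => e e0.
    have [|z Fz] := F_cauchy e%:C; first by rewrite ltcR.
    exists (h z); apply: (@filterS _ F _ _ _ _ Fz) => w.
    rewrite -!ball_normE /= => zw.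
    by rewrite -ltcR (le_lt_trans (h_lip _ _)).
  by exists r => e e0; move/cvgrPdist_lt: Fr; exact.
have [|a Fa] := cvg_part (@complex.Re R).
  by move=> z w; rewrite -raddfB normc_ge_Re.
have [|b Fb] := cvg_part (@complex.Im R).
  move=> z w; rewrite -raddfB -normrN -ReiNIm.
  by rewrite (le_trans (normc_ge_Re _))// normrM normci mulr1.
apply/cvg_ex; exists (a +i* b); apply/cvgrPdist_lt => e e0.
have [r er] : exists r : R, e = r%:C.
  by apply/complex_realP; exact: gtr0_real.
have r0 : 0 < r by rewrite -ltcR -er.
near=> z.
have az : `|a - complex.Re z| < r / 2 by near: z; apply: Fa; rewrite divr_gt0.
have bz : `|b - complex.Im z| < r / 2 by near: z; apply: Fb; rewrite divr_gt0.
rewrite er [_ - z]complexE (le_lt_trans (ler_normD _ _))//.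
rewrite normrM normci mul1r !normc_real !raddfB /= -rmorphD ltcR [r]splitr.
exact: ltrD.
Unshelve. all: by end_near. Qed.

(** * Bounded functions with the supremum norm *)

Section FunctionAlgebra.
Variables (T : pointedType) (K : comNzRingType) (A : comAlgType K).

Fact fct_scalerAl (a : K) (f g : T -> A) : a *: (f * g) = (a *: f) * g.
Proof. by apply/funext => t; exact: scalerAl. Qed.

HB.instance Definition _ :=
  GRing.Lmodule_isLalgebra.Build K (T -> A) fct_scalerAl.

HB.instance Definition _ := GRing.Lalgebra_isComAlgebra.Build K (T -> A).

End FunctionAlgebra.

HB.instance Definition _ (R : realType) :=
  GRing.Lalgebra_isComAlgebra.Build R[i] R[i].

Section BoundedFunctions.
Variables (R : realType) (T : pointedType).
Local Notation C := R[i].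

Definition bounded_fct : {pred T -> C} :=
  [pred f | `[< exists M, forall t, `|f t| <= M >]].

Fact bounded_fct_subalg : GRing.subalg_closed bounded_fct.
Proof.
split=> [|a f g /asboolP[M fM] /asboolP[N gN]|
          f g /asboolP[M fM] /asboolP[N gN]]; apply/asboolP.
- by exists 1 => t; rewrite normr1.
- exists (`|a| * M + N) => t; apply: (le_trans (ler_normD _ _)).
  by rewrite lerD // normrM ler_wpM2l.
- by exists (M * N) => t; rewrite normrM ler_pM.
Qed.

HB.instance Definition _ :=
  GRing.isSubalgClosed.Build C (T -> C) bounded_fct bounded_fct_subalg.

(** The algebra usually written l^oo(T).  The index type is pointed because an
    algebra is required to satisfy [1 != 0]. *)
Record linf := Linf {linf_val :> T -> C; _ : linf_val \in bounded_fct}.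

HB.instance Definition _ := [isSub for linf_val].
HB.instance Definition _ := [Choice of linf by <:].
HB.instance Definition _ := [SubChoice_isSubAlgebra of linf by <:].
HB.instance Definition _ := [SubNzRing_isSubComNzRing of linf by <:].

Implicit Types (f g : linf) (M : C).

(** Moduli of complex numbers are themselves complex numbers here, and suprema
    only exist in [R]; [linf_norm_ge] and [linf_norm_le] characterize this norm
    as the least upper bound of the moduli and hide the detour through [R]. *)
Definition linf_norm f : C := (sup [set complex.Re `|f t| | t in setT])%:C.

Lemma linf_bounded f : exists M, forall t, `|f t| <= M.
Proof. by case: f => f f_bounded; exact/asboolP. Qed.

Lemma linf_norm_ge f t : `|f t| <= linf_norm f.
Proof.
have [M fM] := linf_bounded f.
rewrite -[X in X <= _]RRe_real ?normr_real // lecR.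
apply: ub_le_sup; last by exists t.
by exists (complex.Re M) => _ [u _ <-]; have := fM u; rewrite lecE => /andP[].
Qed.

Lemma linf_norm_le f M : (forall t, `|f t| <= M) -> linf_norm f <= M.
Proof.
move=> fM; rewrite -[M]RRe_real; last first.
  by apply: ger0_real; apply: le_trans (fM point).
rewrite lecR; apply: ge_sup; first by exists (complex.Re `|f point|), point.
by move=> _ [u _ <-]; have := fM u; rewrite lecE => /andP[].
Qed.

Lemma linf_norm_ge0 f : 0 <= linf_norm f.
Proof. exact: le_trans (linf_norm_ge f point). Qed.

Fact linf_normD f g : linf_norm (f + g) <= linf_norm f + linf_norm g.
Proof.
apply: linf_norm_le => t; apply: (le_trans (ler_normD _ _)).
by rewrite lerD ?linf_norm_ge.
Qed.

Fact linf_normM f g : linf_norm (f * g) <= linf_norm f * linf_norm g.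
Proof.
apply: linf_norm_le => t; rewrite normrM.
by rewrite ler_pM ?linf_norm_ge.
Qed.

(** Homogeneity follows from the inequality for [M] and for its inverse. *)
Fact linf_normZ M f : linf_norm (M *: f) = `|M| * linf_norm f.
Proof.
have leZ N g : linf_norm (N *: g) <= `|N| * linf_norm g.
  by apply: linf_norm_le => t; rewrite normrM ler_wpM2l ?linf_norm_ge.
apply/eqP; rewrite eq_le leZ /=; have [->|M0] := eqVneq M 0.
  by rewrite normr0 mul0r linf_norm_ge0.
rewrite -ler_pdivlMl ?normr_gt0 // -normfV.
by rewrite -[X in linf_norm X <= _](scalerK M0).
Qed.

Lemma linfP f g : f =1 g -> f = g.
Proof. by move=> fg; apply/val_inj/funext. Qed.

Fact linf_norm0_eq0 f : linf_norm f = 0 -> f = 0.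
Proof.
move=> f0; apply: linfP => t; apply/eqP.
by rewrite -normr_le0 -f0 linf_norm_ge.
Qed.

Fact linf_norm1 : linf_norm 1 = 1.
Proof.
apply/eqP; rewrite eq_le linf_norm_le /=; last by move=> t; rewrite normr1.
by rewrite -[X in X <= _]normr1 (linf_norm_ge 1 point).
Qed.

HB.instance Definition _ := isNormedAlgebra.Build C linf
  linf_normD linf_normZ linf_norm0_eq0 linf_normM linf_norm1.

(** The pointwise limit [l] exists because [R[i]] is complete, and the Cauchy
    condition is uniform in the argument, so that the convergence to [l] is too;
    this gives both the boundedness of [l] and the convergence in norm. *)
Fact linf_complete (F : set_system (normed_space linf)) :
  ProperFilter F -> cauchy F -> cvg F.
Proof.
move=> FF /[dup] /cauchyP F_cauchy_ex /cauchy_ballP F_cauchy.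
have limP (t : T) : exists l : C, (f : linf) t @[f --> F] --> l.
  apply/cvg_ex; apply: complex_complete; apply/cauchyP => e /F_cauchy_ex[f Ff].
  exists ((f : linf) t); apply: (@filterS _ F _ _ _ _ Ff) => g.
  rewrite -!ball_normE /= normed_spaceE; apply: le_lt_trans.
  exact: (linf_norm_ge (f - g : linf) t).
have [l Fl] := choice limP.
have near_lim (e : C) : 0 < e ->
    \forall f \near F, forall t, `|l t - (f : linf) t| <= e.
  move=> e0; have e20 : 0 < e / 2 by rewrite divr_gt0.
  near=> f => t; near F => g.
  rewrite [e]splitr (le_trans (ler_distD ((g : linf) t) _ _)) // lerD //.
    by near: g; move/cvgrPdist_le: (Fl t); exact.
  apply: (le_trans (linf_norm_ge (g - f : linf) t)); apply: ltW.
  suff : ball g (e / 2) f by rewrite -ball_normE.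
  by apply: ball_sym; near: g; near: f; apply: nearP_dep; exact: F_cauchy.
have l_bounded : l \in bounded_fct.
  near F => f; apply/asboolP; exists (1 + linf_norm f) => t.
  rewrite -[l t](subrK ((f : linf) t)) (le_trans (ler_normD _ _)) //.
  by rewrite lerD ?linf_norm_ge //; move: t; near: f; exact: near_lim.
apply/cvg_ex; exists (Linf l_bounded : normed_space linf).
apply/cvgrPdist_le => e /near_lim; apply: (@filterS _ F) => f lf.
by rewrite normed_spaceE; exact: linf_norm_le.
Unshelve. all: by end_near. Qed.

HB.instance Definition _ :=
  NormedAlgebra_isComplete.Build C linf linf_complete.

End BoundedFunctions.

(** * Joint spectra of bounded functions *)

Section BoundedFunctionsSpectrum.
Variables (R : realType) (T : pointedType).
Local Notation C := R[i].

Lemma linf_prodE (I : finType) (f : I -> linf R T) (k : I -> nat) t :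
  (\prod_i f i ^+ k i) t = \prod_i f i t ^+ k i.
Proof.
apply: (big_ind2 (fun (g : linf R T) z => g t = z)) => //.
  by move=> g _ h _ <- <-.
by move=> i _; elim: (k i) => // m IH; rewrite !exprS -IH.
Qed.

Lemma linf_sumE (I : finType) (f : I -> linf R T) t :
  (\sum_i f i) t = \sum_i f i t.
Proof.
by apply: (big_ind2 (fun (g : linf R T) z => g t = z)) => // g _ h _ <- <-.
Qed.

(** With [g] the sum of the squared moduli of the [u j], which is at least
    [e ^+ 2], the coefficients [(u j)^* / g] are bounded and solve the
    equation. *)
Lemma linf_unimodular n (u : 'I_n -> linf R T) (e : C) : 0 < e ->
    (forall t, exists j, e <= `|u j t|) ->
  exists v : 'I_n -> linf R T, \sum_j u j * v j = 1.
Proof.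
move=> e0 ue; pose g t := \sum_j `|u j t| ^+ 2.
have g_ge t : e ^+ 2 <= g t.
  have [j ej] := ue t; rewrite /g (bigD1 j) //= -[e ^+ 2]addr0 lerD //.
    by rewrite ler_pXn2r ?nnegrE ?(ltW e0).
  by apply: sumr_ge0 => k _; rewrite exprn_ge0.
have g0 t : 0 < g t by rewrite (lt_le_trans _ (g_ge t)) // exprn_gt0.
have v_bounded j : (fun t => (u j t)^* / g t) \in @bounded_fct R T.
  apply/asboolP; exists (linf_norm (u j) / e ^+ 2) => t.
  rewrite normrM normcJ ler_pM ?linf_norm_ge // normfV gtr0_norm //.
  by rewrite lef_pV2 ?posrE ?exprn_gt0.
exists (fun j => Linf (v_bounded j)); apply: linfP => t.
have -> : (1 : linf R T) t = g t / g t by rewrite divff // lt0r_neq0.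
rewrite linf_sumE [in RHS]/g mulr_suml; apply: eq_bigr => j _.
by rewrite sqr_normc -mulrA.
Qed.

(** Evaluations give one inclusion.  Conversely, if the tuple [l] of values of
    a character [phi] had a ball around it missing the range of [p], then the
    functions [y j - l j] would generate the unit ideal while lying in the
    kernel of [phi]. *)
Lemma joint_spectrum_linf n (p : T -> 'rV[C]_n) (y : 'I_n -> linf R T) :
    (forall t j, y j t = p t ord0 j) -> closed (range p) ->
  joint_spectrum y = range p.
Proof.
move=> yE p_closed; apply/seteqP; split=> [_ [phi phiP <-]|_ [t _ <-]].
- set l := \row_j _; apply: contrapT => lp.
  have : nbhs l (~` range p)
    by apply: open_nbhs_nbhs; split; first exact: closed_openC.
  move=> /nbhs_ballP[e /= e0 ep].
  pose u j := y j - (phi (y j))%:A.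
  have [t|v uv1] := linf_unimodular (u := u) e0.
    apply: contrapT => /forallNP ue; apply: (ep (p t)); last by exists t.
    split=> // i j; rewrite ord1 -ball_normE /=.
    have /negP := ue j; rewrite -real_ltNge ?normr_real ?gtr0_real //.
    have -> : u j t = y j t - phi (y j) by congr (_ - _); exact: mulr1.
    by rewrite distrC mxE -yE.
  have : phi 1 = 0.
    rewrite -uv1 raddf_sum big1 //= => j _; rewrite phiP.1 raddfB /=.
    by rewrite linearZ /= (character1 phiP) mulr1 subrr mul0r.
  by move/eqP; rewrite (character1 phiP) oner_eq0.
- rewrite (_ : p t = \row_j y j t); last by apply/rowP => j; rewrite mxE yE.
  apply: (@joint_spectrum_mem C (linf R T) n y (fun f => f t)) => //.
  exact: oner_neq0.
Qed.

End BoundedFunctionsSpectrum.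

(** * Enlarging a joint spectrum *)

Theorem lemma3p8 (R : realType) (n : nat) (hn : (1 <= n)%N)
    (A : comBanachAlgType R[i]) (x : 'I_n -> A) (K : set 'rV[R[i]]_n)
    (cK : compact K)
    (sK : K `<=` [set s : 'rV[R[i]]_n | forall i : 'I_n -> nat,
       `|\prod_(j < n) s ord0 j ^+ i j| <= anorm (\prod_(j < n) x j ^+ i j)]) :
  exists (B : comBanachAlgType R[i]) (y : 'I_n -> B),
    (forall i : 'I_n -> nat,
       anorm (\prod_(j < n) y j ^+ i j) = anorm (\prod_(j < n) x j ^+ i j)) /\
    joint_spectrum y = joint_spectrum x `|` K.
Proof.
have [[k0 Kk0]|K0] := pselect (K !=set0); last first.
  exists A, x; split=> //; suff -> : K = set0 by rewrite setU0.
  by apply: contrapT => /eqP/set0P.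
(* Mapping the whole space onto [K] makes [K] the range of a function on a
   pointed type, without turning [K] itself into a type. *)
pose T := [the pointedType of 'rV[R[i]]_n].
pose p (s : T) : 'rV[R[i]]_n := if s \in K then s else k0.
have pK s : K (p s) by rewrite /p; case: ifPn => // /set_mem.
have p_range : range p = K.
  apply/seteqP; split=> [_ [s _ <-] //|s Ks].
  by exists s => //; rewrite /p mem_set.
(* Separation comes from the norm of row vectors, which requires a positive
   dimension. *)
have K_closed : closed K.
  case: n hn {A x sK} K cK {k0 Kk0 T p pK p_range}  => // n _ K cK.
  by apply: compact_closed => //; exact: norm_hausdorff.
(* The assumption on [K] for the monomial [x j] bounds the [j]-th coordinate. *)
have z_bounded j : (fun t => p t ord0 j) \in @bounded_fct R T.
  apply/asboolP; exists (anorm (\prod_(k < n) x k ^+ (k == j))) => t.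
  have := sK _ (pK t) (fun k => k == j).
  rewrite [in X in X -> _](bigD1 j) //= eqxx expr1 big1 ?mulr1 //.
  by move=> k /negPf ->.
pose z j := Linf (z_bounded j).
exists (A * linf R T)%type, (fun j => (x j, z j)); split=> [i|].
  have -> : \prod_(j < n) (x j, z j) ^+ i j =
      (\prod_(j < n) x j ^+ i j, \prod_(j < n) z j ^+ i j).
    rewrite [LHS]surjective_pairing !rmorph_prod.
    by congr (_, _); apply: eq_bigr => j _; rewrite rmorphXn.
  rewrite anorm_pairE; apply: max_l; apply: linf_norm_le => t.
  by rewrite linf_prodE; exact: sK.
by rewrite joint_spectrum_prod (joint_spectrum_linf (p := p)) ?p_range.
Qed.
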